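(* Let $(G,\omega)$ be a connected decorated planar graph, and let $S$ be an $\omega$-admissible potential for $G$. Then for every BMS state $\xi=(f_+,f_-,d)$ for $(G,\omega)$ the representation $\mathcal{M}(\xi)$ of the quiver $\mathcal{Q}G$ is a representation of the Jacobian algebra $\mathcal{P}(\mathcal{Q}G,S)$.
   Context: **Planar graphs.** $G=(V_G,E_G)$ is a finite connected undirected multigraph (multiple edges allowed) without loops, with every vertex of degree $\ge 2$, embedded in the oriented sphere $S^2$; $F_G$ is its set of faces. An angle at a vertex $v$ is a pair of half-edges at $v$ that are consecutive in the clockwise cyclic order around $v$; it is oriented clockwise, from its source edge $s(a)$ to its target edge $t(a)$ (the next edge clockwise), and lies in one face. $A_G$ is the set of angles; $A_G(v)$, $A_G(f)$ are those at a vertex $v$, resp. in a face $f$. The directed medial graph (a quiver without loops) $\mathcal{Q}G$ has vertex set $E_G$ and one arrow $s(a)\to t(a)$ for each $a\in A_G$. For $x\in V_G\sqcup F_G$ the arrows $A_G(x)$ form an oriented cycle $\mathcal{Q}G(x)$ of $\mathcal{Q}G$ (going around $x$). **Weights.** A weight is a class $\omega\in H^1(|\mathcal{Q}G|;\mathbb{Z})$ admitting compatible functions, equivalently a function $\omega\colon V_G\sqcup F_G\to\mathbb{Z}_{\ge0}$ with $\sum_{v}\omega(v)=\sum_f\omega(f)$ ($\omega(x)$ being the value of the class on $\mathcal{Q}G(x)$). An angular function $g\colon A_G\to\mathbb{Z}_{\ge0}$ is $\omega$-compatible if it represents $\omega$ as a cellular 1-cochain, equivalently $\sum_{a\in A_G(x)}g(a)=\omega(x)$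 for all $x\in V_G\sqcup F_G$. $\mathcal{L}(G,\omega)$ is the set of these. **BMS states.** An angular cycle is a cellular 1-cycle $c=\sum_a c_a a$ of $|\mathcal{Q}G|$ with all $c_a\ge0$; it is invisible if $c\neq0$ and $\omega$ takes value $0$ on it, and connected if the arrows with $c_a\ne0$ form a connected subgraph. A BMS state for $(G,\omega)$ is a triple $(f_+,f_-,d)$ with $f_\pm\in\mathcal{L}(G,\omega)$ and $d\colon E_G\to\mathbb{Z}_{\ge0}$ such that $f_+(a)-f_-(a)=d(t(a))-d(s(a))$ for all $a\in A_G$, and $d(e)=0$ for every edge $e$ belonging to a connected invisible angular cycle. **The representation $\mathcal{M}(\xi)$.** $\mathcal{M}(\xi)_e=\mathbb{C}^{d(e)}$ for $e\in E_G$. For an arrow $a$: if $f_-(a)\le d(s(a))$ and $f_+(a)\le d(t(a))$, put $r=d(s(a))-f_-(a)=d(t(a))-f_+(a)\ge0$ and let $\mathcal{M}(\xi)_a\colon\mathbb{C}^{d(s(a))}\to\mathbb{C}^{d(t(a))}$ be the matrix $\begin{pmatrix}0_{r\times f_-(a)}&\mathbb{1}_r\\0_{f_+(a)\times f_-(a)}&0_{f_+(a)\times r}\end{pmatrix}$; otherwise $\mathcal{M}(\xi)_a=0$. **Potentials and Jacobian algebra.** Let $R$ be the span of the lazy paths, $A$ the arrow bimodule of $\mathcal{Q}G$, $R\langle\langle A\rangle\rangle$ the complete path algebra over $\mathbb{C}$, with paths $\alpha_1\cdots\alpha_\ell$ composed so that $t(\alpha_i)=s(\alpha_{i+1})$ (and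 $M_{\alpha_1\cdots\alpha_\ell}=M_{\alpha_\ell}\circ\cdots\circ M_{\alpha_1}$). A potential is a (possibly infinite) linear combination of cyclic paths, i.e. an element of $R\langle\langle A\rangle\rangle_{\rm cyc}$; the cyclic derivative is $\partial_\alpha(\alpha_1\cdots\alpha_d)=\sum_{k:\alpha_k=\alpha}\alpha_{k+1}\cdots\alpha_d\alpha_1\cdots\alpha_{k-1}$. $J(S)$ is the closure of the two-sided ideal generated by all $\partial_\alpha(S)$ and $\mathcal{P}(\mathcal{Q}G,S)=R\langle\langle A\rangle\rangle/J(S)$. A representation of $\mathcal{P}(\mathcal{Q}G,S)$ is a finite-dimensional nilpotent representation $M$ of $\mathcal{Q}G$ (all sufficiently long paths act by zero) with $\partial_\alpha(S)M=0$ for every arrow $\alpha$. **Admissible potentials.** (The cycles $\mathcal{Q}G(x)$ are given arbitrary base points; the Jacobian algebra does not depend on this.) Phantom potentials are the elements of the subalgebra generated by the $\mathcal{Q}G(x)$ with $x\in V_G\sqcup F_G$, $\omega(x)=0$. Let $\mathrm{supp}(\omega)=\{x:\omega(x)\ne0\}$, $\xi_\omega=\mathrm{lcm}\{\omega(x):x\in\mathrm{supp}(\omega)\}$, $p_\omega(x)=\xi_\omega/\omega(x)$, and $$S_\omega=\sum_{v\in V_G\cap\mathrm{supp}(\omega)}\tfrac1{p_\omega(v)}\mathcal{Q}G(v)^{p_\omega(v)}-\sum_{f\in F_G\cap\mathrm{supp}(\omega)}\tfrac1{p_\omega(f)}\mathcal{Q}G(f)^{p_\omega(f)}.$$ A potential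 $S$ is $\omega$-admissible if $S-S_\omega$ is a phantom potential. *)

(* Defs.v *)
From HB Require Import structures.
From mathcomp Require Import all_boot all_order all_algebra all_fingroup.
From mathcomp Require Import generic_quotient.
From mathcomp Require Import boolp functions reals.
From mathcomp Require Import complex.

Set Implicit Arguments.
Unset Strict Implicit.
Unset Printing Implicit Defensive.

Import GRing.Theory.

Local Open Scope ring_scope.
Local Open Scope quotient_scope.

(* A connected multigraph embedded in the oriented sphere, up to orientation
   preserving homeomorphism, is encoded by its combinatorial map: [dart] is the
   set of half-edges, [nxt] sends a half-edge to the next one clockwise around
   its vertex, and [opp] exchanges the two halves of each edge.  Vertices, edges
   and faces are the cycles of [nxt], [opp] and [opp \o nxt], and Euler's
   formula says that the surface is a sphere. *)
Record planarGraph := PlanarGraph {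
  dart : finType;
  nxt : {perm dart};
  opp : {perm dart};
  fnxt := (nxt * opp)%g;
  opp_involutive : forall h, opp (opp h) = h;
  opp_neq : forall h, opp h != h;
  no_loop : forall h, opp h \notin porbit nxt h;
  degree_ge2 : forall v, v \in porbits nxt -> (2 <= #|v|)%N;
  map_connected :
    forall h k, connect (fun x y => (y == nxt x) || (y == opp x)) h k;
  euler_formula :
    (#|porbits nxt| + #|porbits fnxt| = #|porbits opp| + 2)%N
}.

Section Quiver.
Variable G : planarGraph.

Definition vertex := {v : {set dart G} | v \in porbits (nxt G)}.
Definition edge := {e : {set dart G} | e \in porbits (opp G)}.
Definition face := {f : {set dart G} | f \in porbits (fnxt G)}.

Lemma edge_of_subproof (h : dart G) :
  porbit (opp G) h \in porbits (opp G).
Proof. exact: imset_f. Qed.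

Definition edge_of (h : dart G) : edge :=
  exist _ (porbit (opp G) h) (edge_of_subproof h).

(* The angle going clockwise from the half-edge h to nxt h is identified with
   its source half-edge h. *)
Definition angle : finType := dart G.
Definition src (a : angle) : edge := edge_of a.
Definition tgt (a : angle) : edge := edge_of (nxt G a).

Definition site := (vertex + face)%type.

Definition angles (x : site) : {set angle} :=
  match x with inl v => val v | inr f => val f end.

(* The angle following a around x.  Around a face, the angle after a starts at
   the other half opp (nxt a) of the edge on which a ends. *)
Definition step (x : site) : {perm angle} :=
  match x with inl _ => nxt G | inr _ => fnxt G end.

(* Cellular cochains of |QG| and the group H^1(|QG|; Z). *)
Definition cochain0 := {ffun edge -> int}.
Definition cochain1 := {ffun angle -> int}.

Definition coboundary (p : cochain0) : cochain1 :=
  [ffun a => p (tgt a) - p (src a)].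

Definition cohomologous : rel cochain1 :=
  fun g h => `[< exists p : cochain0, g - h = coboundary p >].

Lemma cohomologous_refl : reflexive cohomologous.
Proof.
move=> g; apply/asboolP; exists 0; apply/ffunP => a.
by rewrite !ffunE !subrr.
Qed.

Lemma cohomologous_sym : symmetric cohomologous.
Proof.
suff H g h : cohomologous g h -> cohomologous h g.
  by move=> g h; apply/idP/idP; apply: H.
move=> /asboolP [p /ffunP Ep]; apply/asboolP; exists (- p); apply/ffunP => a.
by move: (Ep a); rewrite !ffunE => Ea; rewrite -opprB Ea opprB opprK addrC.
Qed.

Lemma cohomologous_trans : transitive cohomologous.
Proof.
move=> h g k /asboolP [p /ffunP Ep] /asboolP [q /ffunP Eq].
apply/asboolP; exists (p + q); apply/ffunP => a.
move: (Ep a) (Eq a); rewrite !ffunE => Ea Fa.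
by rewrite opprD addrACA -Ea -Fa addrA subrK.
Qed.

Definition cohomologous_equiv :=
  EquivRel cohomologous cohomologous_refl cohomologous_sym cohomologous_trans.

Definition H1_QG := {eq_quot cohomologous_equiv}.

Definition chain1 := {ffun angle -> int}.

Definition is_cycle (c : chain1) : Prop :=
  forall e : edge,
    \sum_(a | tgt a == e) c a = \sum_(a | src a == e) c a.

(* Value of a class on a 1-cycle; [value_pi] shows that it does not depend on
   the representative. *)
Definition value (w : H1_QG) (c : chain1) : int := \sum_a repr w a * c a.

Lemma value_pi (g : cochain1) (c : chain1) :
  is_cycle c -> value (\pi_(H1_QG) g) c = \sum_a g a * c a.
Proof.
move=> cyc; rewrite /value.
have : g = repr (\pi_(H1_QG) g) %[mod H1_QG] by rewrite reprK.
move: (repr _) => r /eqmodP/asboolP[p Ep].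
have {Ep} -> : g = r + coboundary p by rewrite -Ep addrC subrK.
rewrite -[LHS]addr0.
rewrite [RHS](_ : _ = \sum_a r a * c a + \sum_a coboundary p a * c a); last first.
  by rewrite -big_split /=; apply: eq_bigr => a _; rewrite ffunE mulrDl.
have sumE (F : angle -> edge) :
    \sum_a p (F a) * c a = \sum_e p e * \sum_(a | F a == e) c a.
  rewrite (partition_big F predT) //=; apply: eq_bigr => e _.
  by rewrite mulr_sumr; apply: eq_bigr => a /eqP ->.
congr (_ + _); rewrite (eq_bigr (fun a => p (tgt a) * c a - p (src a) * c a)).
  rewrite sumrB !sumE; apply/esym/eqP; rewrite subr_eq0; apply/eqP.
  by apply: eq_bigr => e _; rewrite cyc.
by move=> a _; rewrite ffunE mulrBl.
Qed.

Definition angular_function := {ffun angle -> nat}.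

Definition class_of (g : angular_function) : H1_QG :=
  \pi_(H1_QG) [ffun a => (g a)%:Z].

Record weight := Weight {
  weight_class :> H1_QG;
  weight_compatible : exists g : angular_function, class_of g = weight_class
}.

Definition site_chain (x : site) : chain1 :=
  [ffun a => (a \in angles x)%:R].

Lemma src_step (x : site) (a : angle) : src (step x a) = tgt a.
Proof.
case: x => x //=; apply: val_inj; rewrite /= permM.
by apply/eqP; rewrite eq_porbit_mem (mem_porbit (opp G) 1).
Qed.

Lemma step_angles (x : site) (a : angle) :
  (step x a \in angles x) = (a \in angles x).
Proof.
case: x => -[_ /= /imsetP[h _ ->]]; rewrite -!eq_porbit_mem;
  congr (_ == _); exact: (porbit_perm _ 1).
Qed.

Lemma site_chain_cycle (x : site) : is_cycle (site_chain x).
Proof.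
move=> e; rewrite [RHS](reindex_inj (@perm_inj _ (step x))) /=.
by apply: eq_big => [a|a _]; rewrite ?src_step // !ffunE step_angles.
Qed.

Section Weighted.
Variable w : weight.

(* omega(x); the value is nonnegative, so taking its absolute value loses
   nothing: see [wval_compatible]. *)
Definition wval (x : site) : nat := `|value w (site_chain x)|%N.

Definition compatible (g : angular_function) : Prop := class_of g = w.

Lemma wval_compatible (g : angular_function) (x : site) :
  compatible g -> wval x = (\sum_(a in angles x) g a)%N.
Proof.
rewrite /wval /compatible => <-; rewrite value_pi; last exact: site_chain_cycle.
rewrite -[RHS]absz_nat; congr (`|_|%N).
rewrite -natz natr_sum [RHS]big_mkcond /=; apply: eq_bigr => a _.
by rewrite !ffunE; case: (_ \in _); rewrite ?mulr1 ?mulr0 // natz.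
Qed.

Definition angular_cycle (c : chain1) : Prop :=
  is_cycle c /\ forall a, 0 <= c a.

Definition invisible (c : chain1) : Prop := c != 0 /\ value w c = 0.

Definition on_chain (c : chain1) (e : edge) : bool :=
  [exists a, (c a != 0) && ((src a == e) || (tgt a == e))].

Definition chain_adj (c : chain1) : rel edge :=
  fun e e' => [exists a, (c a != 0) &&
    (((src a == e) && (tgt a == e')) || ((src a == e') && (tgt a == e)))].

Definition connected_chain (c : chain1) : Prop :=
  forall e e', on_chain c e -> on_chain c e' -> connect (chain_adj c) e e'.

Record bms_state := BMSState {
  fplus : angular_function;
  fminus : angular_function;
  bdim : edge -> nat;
  fplus_compatible : compatible fplus;
  fminus_compatible : compatible fminus;
  bms_balance : forall a,
    (fplus a)%:Z - (fminus a)%:Z = (bdim (tgt a))%:Z - (bdim (src a))%:Z;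
  bms_vanish : forall (c : chain1) (e : edge),
    angular_cycle c -> invisible c -> connected_chain c -> on_chain c e ->
    bdim e = 0%N
}.

End Weighted.

Record base_points := BasePoints {
  base :> site -> angle;
  base_in : forall x, base x \in angles x
}.

(* A path is a pair (e, s) of its starting vertex and its sequence of arrows;
   (e, [::]) is the lazy path at e. *)
Fixpoint is_path (e : edge) (s : seq angle) : bool :=
  if s is a :: s' then (src a == e) && is_path (tgt a) s' else true.

Definition target (e : edge) (s : seq angle) : edge := last e (map tgt s).

Section PathAlgebra.
Variable R : realType.
Local Notation C := (complex R).

(* An element of the complete path algebra is a family of coefficients indexed
   by paths, extended by 0 to the pairs (e, s) that are not paths. *)
Definition cpa := edge * seq angle -> C.

Definition cpa_one : cpa := fun p => (p.2 == [::])%:R.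

Definition cpa_mul (u v : cpa) : cpa := fun p =>
  \sum_(i < (size p.2).+1)
    u (p.1, take i p.2) * v (target p.1 (take i p.2), drop i p.2).

Definition cpa_exp (u : cpa) (n : nat) : cpa := iter n (cpa_mul u) cpa_one.

Definition cpa_path (e : edge) (s : seq angle) : cpa :=
  fun p => (p == (e, s))%:R.

Definition is_cyclic_path (e : edge) (s : seq angle) : bool :=
  [&& s != [::], is_path e s & target e s == e].

Definition is_potential (S : cpa) : Prop :=
  forall e s, ~~ is_cyclic_path e s -> S (e, s) = 0.

(* Linear extension of the cyclic derivative to infinite combinations: the
   coefficient of p in the derivative is the sum, over the cyclic paths (e, c)
   and the positions k with c_k = alpha for which the rotated path
   c_{k+1} ... c_n c_1 ... c_{k-1} (which starts at tgt alpha) is p, of the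
   coefficient of (e, c) in S.  Only c with (size p).+1 arrows contribute. *)
Definition cyc_deriv (alpha : angle) (S : cpa) : cpa := fun p =>
  \sum_(e : edge) \sum_(c : (size p.2).+1.-tuple angle)
    \sum_(k < (size p.2).+1 | tnth c k == alpha)
      if p == (tgt alpha, drop k.+1 c ++ take k c) then S (e, val c) else 0.

Section Potentials.
Variables (w : weight) (b : base_points).

Definition QG (x : site) : cpa :=
  cpa_path (src (b x)) (traject (step x) (b x) #|angles x|).

Inductive phantom_subalgebra : cpa -> Prop :=
| phantom_gen x : wval w x = 0%N -> phantom_subalgebra (QG x)
| phantom_one : phantom_subalgebra cpa_one
| phantom_add u v : phantom_subalgebra u -> phantom_subalgebra v ->
    phantom_subalgebra (u + v)
| phantom_scale (z : C) u : phantom_subalgebra u ->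
    phantom_subalgebra (fun p => z * u p)
| phantom_mul u v : phantom_subalgebra u -> phantom_subalgebra v ->
    phantom_subalgebra (cpa_mul u v).

Definition phantom_potential (u : cpa) : Prop :=
  phantom_subalgebra u /\ is_potential u.

Definition xi_w : nat := \big[lcmn/1%N]_(x : site | wval w x != 0%N) wval w x.

Definition p_w (x : site) : nat := (xi_w %/ wval w x)%N.

Definition S_w : cpa := fun p =>
  \sum_(v : vertex | wval w (inl v) != 0%N)
     (p_w (inl v))%:R^-1 * cpa_exp (QG (inl v)) (p_w (inl v)) p
  - \sum_(f : face | wval w (inr f) != 0%N)
     (p_w (inr f))%:R^-1 * cpa_exp (QG (inr f)) (p_w (inr f)) p.

Definition admissible (S : cpa) : Prop :=
  is_potential S /\ phantom_potential (S - S_w).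

End Potentials.

Record qrep := QRep {
  rdim : edge -> nat;
  rmap : forall a : angle, 'M[C]_(rdim (tgt a), rdim (src a))
}.

Section Representations.
Variable M : qrep.

(* Action of an arrow on the total space, as a block from M_e to M_e'.  When
   src a = e and tgt a = e', [conform_mx] is just a type cast. *)
Definition arrow_block (a : angle) (e e' : edge) :
    'M[C]_(rdim M e', rdim M e) :=
  if (src a == e) && (tgt a == e') then conform_mx 0 (rmap M a) else 0.

(* Block from M_e to M_e' of the action of the path (e, s): arrows act from
   first to last, and the block is zero unless (e, s) is a path ending at e'. *)
Fixpoint path_block (s : seq angle) (e e' : edge) :
    'M[C]_(rdim M e', rdim M e) :=
  match s with
  | [::] => if e == e' then conform_mx 0 (1%:M : 'M[C]_(rdim M e)) else 0
  | a :: s' => path_block s' (tgt a) e' *m arrow_block a e (tgt a)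
  end.

Definition nilpotent_from (N : nat) : Prop :=
  forall s e e', (N <= size s)%N -> path_block s e e' = 0.

(* Action of the part of u of length < N; if [nilpotent_from N] holds, this is
   the action of u itself. *)
Definition act (N : nat) (u : cpa) (e e' : edge) :
    'M[C]_(rdim M e', rdim M e) :=
  \sum_(n < N) \sum_(s : n.-tuple angle) u (e, val s) *: path_block s e e'.

Definition jacobian_rep (S : cpa) : Prop :=
  exists N, nilpotent_from N /\
    forall alpha e e', act N (cyc_deriv alpha S) e e' = 0.

End Representations.

(* Since r + f_+(a) = d(t(a)) and f_-(a) + r = d(s(a)), [conform_mx] is again
   just a type cast. *)
Definition bms_rep (w : weight) (xi : bms_state w) : qrep :=
  @QRep (bdim xi) (fun a =>
    let r := (bdim xi (src a) - fminus xi a)%N in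
    if (fminus xi a <= bdim xi (src a))%N && (fplus xi a <= bdim xi (tgt a))%N
    then conform_mx 0
      (block_mx (0 : 'M[C]_(r, fminus xi a)) (1%:M : 'M[C]_r)
                (0 : 'M[C]_(fplus xi a, fminus xi a))
                (0 : 'M[C]_(fplus xi a, r)))
    else 0).

End PathAlgebra.
End Quiver.

(* Main.v *)
(* The arrow [a] sends the basis vector of index [j] to the one of index
   [j - f_-(a)], or to 0 when [j < f_-(a)]; hence a path acts as a shift by the
   sum of f_- along it.  A closed path along which f_- vanishes is a connected
   invisible angular cycle, so [d] vanishes on all its edges.  This gives
   nilpotency, because a nonzero path cannot return to the same basis vector,
   and it kills the derivatives of the phantom part of [S].  An angle [alpha]
   lies around one vertex and one face; the corresponding two terms of
   [cyc_deriv alpha S_w] both act as the shift by [xi_w - f_-(alpha)], with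
   opposite signs, so they cancel. *)

Require Import Defs.
From mathcomp Require Import all_boot all_order all_algebra reals.
From mathcomp Require Import perm boolp functions complex.
From mathcomp Require Import zify.

Set Implicit Arguments.
Unset Strict Implicit.
Unset Printing Implicit Defensive.

Import GRing.Theory Num.Theory.

Local Open Scope ring_scope.

(** * Sums with multiplicities and matrix casts *)

Lemma sum_seq_count_mem (T : finType) (F : T -> nat) (s : seq T) :
  (\sum_(a <- s) F a = \sum_a F a * count_mem a s)%N.
Proof.
elim: s => [|b s IHs]; first by rewrite big_nil big1 // => a _; rewrite muln0.
rewrite big_cons IHs [in RHS](eq_bigr (fun a => F a * (b == a) + F a * count_mem a s)%N).
  rewrite big_split /=; congr (_ + _)%N.
  rewrite (bigD1 b) //= eqxx muln1 big1 ?addn0 // => a /negPf.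
  by rewrite eq_sym => ->; rewrite muln0.
by move=> a _; rewrite /= mulnDr.
Qed.

(** Serves to single out the unique vertex, and the unique face, around which a given angle lies. *)
Lemma sum_mem_unique (K : pzSemiRingType) (T I : finType) (A : I -> {set T}) (P : pred I)
    (t : T) (i0 : I) :
  (forall i, t \in A i -> i = i0) -> t \in A i0 -> P i0 ->
  \sum_(i | P i) (t \in A i)%:R = 1 :> K.
Proof.
move=> uniq_i0 ti0 Pi0; rewrite (bigD1 i0) //= ti0 big1 ?addr0 // => i.
by case/andP=> _; case: (boolP (t \in A i)) => // /uniq_i0 ->; rewrite eqxx.
Qed.

Lemma conform_mxE (K : Type) (m n m' n' : nat) (B : 'M[K]_(m, n))
    (A : 'M[K]_(m', n')) (i : 'I_m) (j : 'I_n) (i' : 'I_m') (j' : 'I_n') :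
  m' = m -> n' = n -> val i = val i' -> val j = val j' ->
  conform_mx B A i j = A i' j'.
Proof.
move=> Em En; case: m / Em B i => B i; case: n / En B j => B j.
by rewrite conform_mx_id => /val_inj -> /val_inj ->.
Qed.

(** * Paths of the quiver as cellular 1-chains *)

Section Paths.
Variable G : planarGraph.
Implicit Types (e : edge G) (s t : seq (angle G)) (a : angle G) (x : site G).

Lemma is_path_cat e s t :
  is_path e (s ++ t) = is_path e s && is_path (target e s) t.
Proof. by elim: s e => //= a s IHs e; rewrite IHs andbA. Qed.

Lemma target_cat e s t : target e (s ++ t) = target (target e s) t.
Proof. by rewrite /target map_cat last_cat. Qed.

Definition path_chain s : chain1 G := [ffun a => (count_mem a s)%:R].

Lemma path_chain_neq0 s a : (path_chain s a != 0) = (a \in s).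
Proof. by rewrite ffunE pnatr_eq0 -lt0n -has_count has_pred1. Qed.

(** A path leaves each vertex as often as it enters it, up to its two endpoints; the endpoint terms
    are added on opposite sides to avoid subtraction in [nat]. *)
Lemma count_tgt_src e s e1 : is_path e s ->
  (count (fun a => tgt a == e1) s + (e == e1) =
   count (fun a => src a == e1) s + (target e s == e1))%N.
Proof.
elim: s e => //= a s IHs e /andP[/eqP <- /IHs]; rewrite /target /=.
by move: (last _ _ == e1) (tgt a == e1) (src a == e1) => x y z; lia.
Qed.

Lemma path_chain_cycle e s :
  is_path e s -> target e s = e -> is_cycle (path_chain s).
Proof.
move=> Ps Ts e1.
have sumE (P : pred (angle G)) : \sum_(a | P a) path_chain s a = (count P s)%:R.
  rewrite -sum1_count [in RHS]big_mkcond sum_seq_count_mem natr_sum big_mkcond /=.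
  by apply: eq_bigr => a _; rewrite ffunE; case: (P a); rewrite ?mul1n ?mul0n.
rewrite !sumE; congr _%:R.
by have := count_tgt_src e1 Ps; rewrite Ts => /addIn.
Qed.

(** The chain [c] is kept independent of [s], so that it stays fixed while the induction shortens
    the path. *)
Lemma path_chain_connect (c : chain1 G) e s :
  is_path e s -> (forall a, a \in s -> c a != 0) ->
  forall a, a \in s ->
    connect (chain_adj c) e (src a) && connect (chain_adj c) e (tgt a).
Proof.
elim: s e => //= a s IHs e /andP[/eqP <- Ps] cs.
have adj : connect (chain_adj c) (src a) (tgt a).
  by apply/connect1/existsP; exists a; rewrite cs ?mem_head // !eqxx.
move=> a'; rewrite inE => /predU1P[->|a's]; first by rewrite connect0.
have [|h1 h2] := andP (IHs _ Ps _ _ a's).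
  by move=> a1 a1s; rewrite cs // inE a1s orbT.
by rewrite !(connect_trans adj).
Qed.

Lemma path_chain_connected e s : is_path e s -> connected_chain (path_chain s).
Proof.
move=> Ps.
have sym : connect_sym (chain_adj (path_chain s)).
  apply: sym_connect_sym => e1 e2; apply: eq_existsb => a.
  by rewrite orbC.
have to_e e1 : on_chain (path_chain s) e1 -> connect (chain_adj (path_chain s)) e e1.
  case/existsP=> a /andP[]; rewrite path_chain_neq0 => sa.
  have /(_ _ sa)/andP[h1 h2] := path_chain_connect Ps
    (fun a => etrans (path_chain_neq0 s a)).
  by case/orP=> /eqP <-.
by move=> e1 e2 /to_e h1 /to_e h2; rewrite (connect_trans _ h2) // sym.
Qed.

(** On a cycle the class can be evaluated through any representative, hence through any compatible
    function. *)
Lemma value_path_chain (w : weight G) (g : angular_function G) e s :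
  compatible w g -> is_path e s -> target e s = e ->
  value w (path_chain s) = (\sum_(a <- s) g a)%N%:Z.
Proof.
move=> <- Ps Ts; rewrite value_pi; last exact: path_chain_cycle Ps Ts.
rewrite sum_seq_count_mem -natz natr_sum; apply: eq_bigr => a _.
by rewrite !ffunE -natz natrM.
Qed.

Lemma angles_porbit x a : a \in angles x -> angles x = porbit (step x) a.
Proof.
by case: x => -[_ /= /imsetP[h _ ->]] /=; rewrite -eq_porbit_mem => /eqP.
Qed.

(** * The cycle around a vertex or a face, as a closed path *)

Section SitePath.
Variables (x : site G) (a0 : angle G) (a0x : a0 \in angles x).

Definition site_path : seq (angle G) := traject (step x) a0 #|angles x|.

Lemma mem_site_path a : (a \in site_path) = (a \in angles x).
Proof. by rewrite /site_path (angles_porbit a0x) -porbit_traject. Qed.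

Lemma count_site_path a : count_mem a site_path = (a \in angles x).
Proof.
rewrite count_uniq_mem ?mem_site_path //.
by rewrite /site_path (angles_porbit a0x) uniq_traject_porbit.
Qed.

Lemma is_path_site_path : is_path (src a0) site_path.
Proof.
suff path_traject n a : is_path (src a) (traject (step x) a n) by exact: path_traject.
by elim: n a => //= n IHn a; rewrite eqxx -(src_step x) IHn.
Qed.

Lemma target_site_path : target (src a0) site_path = src a0.
Proof.
have tgtE n : target (src a0) (traject (step x) a0 n) = src (iter n (step x) a0).
  elim: n => // n IHn; rewrite trajectSr -cats1 target_cat IHn /=.
  by rewrite src_step.
by rewrite tgtE (angles_porbit a0x) iter_porbit.
Qed.

Lemma sum_site_path (w : weight G) (g : angular_function G) :
  compatible w g -> (\sum_(a <- site_path) g a)%N = wval w x.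
Proof.
move=> wg; rewrite (wval_compatible _ wg) sum_seq_count_mem [in RHS]big_mkcond /=.
by apply: eq_bigr => a _; rewrite count_site_path; case: ifP; lia.
Qed.

End SitePath.

(** * Dimensions of a BMS state along paths *)

Section Vanishing.
Variables (w : weight G) (xi : bms_state w).

Lemma bdim_closed_path e s a :
  is_path e s -> target e s = e -> (\sum_(b <- s) fminus xi b = 0)%N ->
  a \in s -> bdim xi (src a) = 0%N /\ bdim xi (tgt a) = 0%N.
Proof.
move=> Ps Ts s0 sa.
have van e1 : on_chain (path_chain s) e1 -> bdim xi e1 = 0%N.
  apply: bms_vanish; last exact: path_chain_connected Ps.
  - by split; [exact: path_chain_cycle Ps Ts | move=> b; rewrite ffunE ler0n].
  - split; last by rewrite (value_path_chain (fminus_compatible xi) Ps Ts) s0.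
    by apply: contraTneq sa => s0'; rewrite -path_chain_neq0 s0' ffunE eqxx.
by split; apply: van; apply/existsP; exists a;
  rewrite path_chain_neq0 sa eqxx ?orbT.
Qed.

(** If the weight of [x] were 0, the cycle around [x] would be a closed path through [a] with zero
    [fminus], forcing [bdim] to vanish at [tgt a]. *)
Lemma wval_neq0 x a :
  a \in angles x -> (0 < bdim xi (tgt a))%N -> wval w x != 0%N.
Proof.
move=> ax; rewrite lt0n; apply: contraNneq => x0.
have [] := @bdim_closed_path (src a) (site_path x a) a => //.
- exact: is_path_site_path.
- exact: target_site_path.
- by rewrite (sum_site_path ax (fminus_compatible xi)).
- by rewrite mem_site_path.
- by move=> _ /eqP.
Qed.

Lemma fminus_fplus a :
  (fplus xi a + bdim xi (src a) = fminus xi a + bdim xi (tgt a))%N.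
Proof. by have := bms_balance xi a; lia. Qed.

(** Along an arrow [bdim] drops by at most [fminus], so an index that can be lowered by [fminus]
    stays below the new dimension. *)
Lemma path_bdim e s j : is_path e s -> (j < bdim xi e)%N ->
  (\sum_(a <- s) fminus xi a <= j)%N ->
  (j - \sum_(a <- s) fminus xi a < bdim xi (target e s))%N.
Proof.
elim: s e j => [|a s IHs] e j /=; first by rewrite big_nil subn0.
case/andP=> /eqP <- Ps ltj; rewrite big_cons => lej.
rewrite subnDA; apply: IHs => //; have := fminus_fplus a; lia.
Qed.

(** Pigeonhole: the pairs formed by the edge reached and the basis index reached after each arrow
    are pairwise distinct. *)
Lemma long_path e s j : is_path e s -> (j < bdim xi e)%N ->
  (\sum_(a <- s) fminus xi a <= j)%N ->
  (size s < #|{: edge G}| * (\max_e bdim xi e))%N.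
Proof.
move=> Ps ltj lej; set D := (\max_e bdim xi e)%N.
pose pos k := (j - \sum_(a <- take k s) fminus xi a)%N.
have take_le k : (\sum_(a <- take k s) fminus xi a <= j)%N.
  by apply: leq_trans lej; rewrite -{2}(cat_take_drop k s) big_cat leq_addr.
have Ptake k : is_path e (take k s).
  by move: Ps; rewrite -{1}(cat_take_drop k s) is_path_cat => /andP[].
have pos_lt k : (pos k < bdim xi (target e (take k s)))%N by exact: path_bdim.
have pos_D k : (pos k < D)%N by exact: leq_trans (pos_lt k) (leq_bigmax _).
pose state (k : 'I_(size s).+1) := (target e (take k s), Ordinal (pos_D k)).
suff inj : injective state.
  by have := leq_card _ inj; rewrite card_prod !card_ord.
(* If a pair recurs, the segment [t] in between is closed and has zero [fminus], so [bdim] vanishes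
   where it starts; but the index [pos k] lies below that dimension. *)
have noloop (k l : 'I_(size s).+1) : state k = state l -> ~ (k < l)%N.
  case=> Ekl posE ltkl; set t := drop k (take l s).
  have takeE : take l s = take k s ++ t.
    by rewrite -(cat_take_drop k (take l s)) take_takel // ltnW.
  have := pos_lt k; have := Ptake l; rewrite takeE is_path_cat => /andP[_ Pt].
  have Tt : target (target e (take k s)) t = target e (take k s).
    by rewrite -target_cat -takeE.
  have t0 : (\sum_(a <- t) fminus xi a = 0)%N.
    move: posE (take_le l); rewrite /pos takeE big_cat /=; lia.
  have : (0 < size t)%N.
    by rewrite size_drop size_takel ?subn_gt0 // -ltnS.
  case: t Pt Tt t0 {takeE} => //= a t Pt Tt t0 _.
  have [] := @bdim_closed_path _ (a :: t) a Pt Tt t0 (mem_head _ _).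
  by move: Pt => /= /andP[/eqP -> _] ->.
move=> k l Ekl; apply: val_inj.
by case: (ltngtP k l) => // ltkl; case: (noloop _ _ _ ltkl).
Qed.

End Vanishing.
End Paths.

(** * Matrix entries of the action of arrows and paths *)

Section Main.
Variables (R : realType) (G : planarGraph) (w : weight G) (xi : bms_state w).
Local Notation M := (bms_rep R xi).
Local Notation fm s := (\sum_(b <- s) fminus xi b)%N.
Implicit Types (e : edge G) (s t : seq (angle G)) (a : angle G) (x : site G).

Lemma rmapE a (i : 'I_(bdim xi (tgt a))) (j : 'I_(bdim xi (src a))) :
  (@rmap G R M a : 'M_(bdim xi (tgt a), bdim xi (src a))) i j =
  (j == i + fminus xi a :> nat)%N%:R.
Proof.
have bal := fminus_fplus xi a; have ltj := ltn_ord j; have lti := ltn_ord i.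
(* When the guard fails the map is 0, and so is the formula: [j = i + fminus xi a] with [j] in range
   would give both inequalities of the guard, by the balance equation. *)
rewrite /=; case: ifP => [/andP[les let_]|ge]; last first.
  by rewrite mxE; case: eqP => // Ej; move: ge; rewrite Ej in ltj *; lia.
set r := (bdim xi (src a) - fminus xi a)%N.
have Er : (r + fplus xi a = bdim xi (tgt a))%N by rewrite /r; lia.
have Es : (fminus xi a + r = bdim xi (src a))%N by rewrite /r; lia.
rewrite (@conform_mxE _ _ _ _ _ _ _ i j (cast_ord (esym Er) i)
  (cast_ord (esym Es) j)) //.
case: (split_ordP (cast_ord (esym Er) i)) => i' Ei;
  case: (split_ordP (cast_ord (esym Es) j)) => j' Ej; rewrite Ei Ej
  ?block_mxEul ?block_mxEur ?block_mxEdl ?block_mxEdr ?mxE;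
  move/(congr1 val): Ei => /= Ei; move/(congr1 val): Ej => /= Ej.
all: have := ltn_ord i'; have := ltn_ord j'.
- by case: eqP => //; lia.
- by rewrite -val_eqE /= => _ _; congr (nat_of_bool _)%:R; apply/eqP/eqP; lia.
- by case: eqP => //; lia.
- by case: eqP => //; lia.
Qed.

Lemma path_blockE s e e' (i : 'I_(bdim xi e')) (j : 'I_(bdim xi e)) :
  (path_block M s e e' : 'M_(bdim xi e', bdim xi e)) i j =
  [&& is_path e s, target e s == e' & j == i + fm s :> nat]%N%:R.
Proof.
elim: s e j => [|a s IHs] e j /=.
  rewrite /target /= big_nil addn0; case: eqP => [Ee|_]; last by rewrite mxE.
  by case: e' / Ee i => i; rewrite conform_mx_id mxE -val_eqE /= eq_sym.
rewrite mxE /arrow_block eqxx andbT; case: eqP => [Ee|_] /=; last first.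
  by apply: big1 => k _; rewrite mxE mulr0.
case: e / Ee j => j; rewrite conform_mx_id big_cons.
under eq_bigr => k _ do rewrite (rmapE k j) IHs -natrM mulnb.
rewrite -natr_sum; congr _%:R; rewrite /target /=; rewrite -/(target (tgt a) s).
case: (is_path _ s); last by rewrite big1.
case: (target _ s == e'); last by rewrite big1.
rewrite /=; have [Ej|nEj] := eqVneq (val j) (i + (fminus xi a + fm s))%N; last first.
  rewrite big1 // => k _; apply/eqP; rewrite eqb0.
  by apply: contraNN nEj => /andP[/eqP Ek /eqP /= ->]; rewrite Ek; apply/eqP; lia.
(* In the matrix product only the intermediate index [i + fm s] contributes; the balance equation
   puts it in range. *)
have ltk : (i + fm s < bdim xi (tgt a))%N.
  by have := ltn_ord j; have := fminus_fplus xi a; rewrite Ej; lia.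
rewrite (bigD1 (Ordinal ltk)) //= [X in (_ + X)%N]big1 ?addn0 => [|k].
  by rewrite eqxx; case: eqP => //= nEj; case: nEj; rewrite [LHS]Ej; lia.
by rewrite -val_eqE /= => /negPf ->.
Qed.

Lemma bms_rep_nilpotent (N : nat) :
  (#|{: edge G}| * (\max_e bdim xi e) <= N)%N -> nilpotent_from M N.
Proof.
move=> leN s e e' leNs; apply/matrixP => i j; rewrite path_blockE mxE.
case: and3P => // -[Ps _ /eqP Ej].
have := @long_path _ _ xi e s j Ps (ltn_ord j); rewrite Ej leq_addl => /(_ isT).
by rewrite ltnNge (leq_trans leN leNs).
Qed.

(** * Action of cyclic derivatives *)

Lemma is_path_rot e s t a : is_path e (s ++ a :: t) ->
  target e (s ++ a :: t) = e ->
  is_path (tgt a) (t ++ s) /\ target (tgt a) (t ++ s) = src a.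
Proof.
rewrite !is_path_cat !target_cat /= => /and3P[Ps /eqP Ea Pt].
by rewrite /target /= -/(target (tgt a) t) => ->; rewrite Pt Ps.
Qed.

(* All rotations of a cyclic path [c] that start right after an occurrence of
   [alpha] act in the same way, since the action only depends on the sum of
   [fminus] over the remaining arrows. *)
Lemma act_cyc_derivE (S : cpa G R) (N : nat) (alpha : angle G) e e'
    (i : 'I_(bdim xi e')) (j : 'I_(bdim xi e)) : is_potential S ->
  (act M N (cyc_deriv alpha S) e e' : 'M_(bdim xi e', bdim xi e)) i j =
  \sum_(n < N) \sum_(e0 : edge G) \sum_(c : n.+1.-tuple (angle G))
    S (e0, val c) * (count_mem alpha c)%:R *
    [&& e == tgt alpha, src alpha == e' &
        j + fminus xi alpha == i + fm c]%N%:R.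
Proof.
move=> potS; rewrite /act summxE; apply: eq_bigr => n _; rewrite summxE.
under eq_bigr => s _.
  rewrite mxE path_blockE /cyc_deriv /= size_tuple mulr_suml.
  over.
rewrite exchange_big; apply: eq_bigr => e0 _.
under eq_bigr => s _ do rewrite mulr_suml.
rewrite exchange_big; apply: eq_bigr => c _ /=.
under eq_bigr => s _ do rewrite mulr_suml.
rewrite exchange_big /=.
have [->|S0] := eqVneq (S (e0, val c)) 0.
  rewrite !mul0r big1 // => k _; rewrite big1 // => s _.
  by case: ifP; rewrite mul0r.
have /and3P[_ Pc /eqP Tc] : is_cyclic_path e0 (val c).
  by apply: contraNT S0 => /potS ->.
(* The multiplicity of [alpha] in [c] is expanded over the positions that hold [alpha], to be
   matched one by one with the terms of the derivative. *)
rewrite -sum1_count big_tuple natr_sum -mulrA mulr_suml mulr_sumr.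
apply: eq_bigr => k /eqP ck; rewrite mul1r.
have Ec : val c = take k c ++ alpha :: drop k.+1 c.
  rewrite -ck (tnth_nth alpha) -drop_nth ?size_tuple //.
  by rewrite cat_take_drop.
have size_rot : size (drop k.+1 c ++ take k c) == n.
  by rewrite size_cat size_drop size_takel size_tuple; have := ltn_ord k; lia.
rewrite Ec in Pc Tc.
(* Among the paths of length [n], only the rotation of [c] at position [k] has a nonzero
   coefficient. *)
rewrite (bigD1 (Tuple size_rot)) //= [X in _ + X]big1 ?addr0 => [|s ns]; last first.
  case: eqP => [[_ Es]|_]; last by rewrite mul0r.
  by case/eqP: ns; apply: val_inj.
rewrite xpair_eqE eqxx andbT; case: eqP => [Ee|_]; last by rewrite mul0r mulr0.
have [Pr Tr] : is_path e (drop k.+1 c ++ take k c) /\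
    target e (drop k.+1 c ++ take k c) = src alpha.
  by rewrite Ee; exact: is_path_rot Pc Tc.
have fmE : (fm c = fm (drop k.+1 c ++ take k c) + fminus xi alpha)%N.
  by rewrite {1}Ec !big_cat big_cons /=; lia.
rewrite Pr Tr /= fmE; congr (_ * (nat_of_bool (_ && _))%:R).
by rewrite addnA eqn_add2r.
Qed.

(** * Powers of closed paths and coefficients of potentials *)

Lemma cpa_mul_path e s t :
  cpa_mul (cpa_path R e s) (cpa_path R (target e s) t) = cpa_path R e (s ++ t).
Proof.
apply: funext => -[e1 u]; rewrite /cpa_mul /cpa_path /=.
have [[-> ->]|ne] := eqVneq (e1, u) (e, s ++ t).
  have lts : (size s < (size (s ++ t)).+1)%N by rewrite ltnS size_cat leq_addr.
  rewrite (bigD1 (Ordinal lts)) //= take_size_cat // drop_size_cat // !eqxx.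
  rewrite mulr1 big1 ?addr0 // => k nk.
  case: eqP => [[Es]|_]; last by rewrite mul0r.
  case/eqP: nk; apply: val_inj => /=; move/(congr1 size): Es => <-.
  by rewrite size_takel // -ltnS.
rewrite big1 // => k _; case: eqP => [[Ee1 Es]|_]; last by rewrite mul0r.
case: eqP => [[_ Et]|_]; last by rewrite mulr0.
by case/eqP: ne; rewrite Ee1 -Es -Et cat_take_drop.
Qed.

(** The exponent is positive because the power 0 is the sum of all lazy paths, not only the one at
    [e]. *)
Lemma cpa_exp_path e s n : target e s = e ->
  cpa_exp (cpa_path R e s) n.+1 = cpa_path R e (flatten (nseq n.+1 s)).
Proof.
move=> Ts; elim: n => [|n IHn].
  rewrite /cpa_exp /= cats0; apply: funext => -[e1 u].
  rewrite /cpa_mul /cpa_one big_ord_recr /= big1 ?add0r => [|k _].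
    by rewrite take_size drop_size mulr1.
  case: eqP => [/(congr1 size)/eqP|_]; last by rewrite mulr0.
  by rewrite size_drop /= subn_eq0 leqNgt ltn_ord.
by rewrite /cpa_exp iterS -/(cpa_exp _ _) IHn -{2}Ts cpa_mul_path.
Qed.

(** A cycle of length [n.+1] has derivatives of length [n], so truncating these below [N] keeps
    exactly the cycles of length 1 to [N]. *)
Lemma sum_cpa_path (N : nat) e s (H : seq (angle G) -> complex R) :
  (0 < size s <= N)%N ->
  \sum_(n < N) \sum_(e0 : edge G) \sum_(c : n.+1.-tuple (angle G))
    cpa_path R e s (e0, val c) * H c = H s.
Proof.
case/andP=> s_gt0 leN; have ltN : ((size s).-1 < N)%N by rewrite prednK.
have size_s : size s == (size s).-1.+1 by rewrite prednK.
rewrite /cpa_path (bigD1 (Ordinal ltN)) //= (bigD1 e) //=.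
rewrite (bigD1 (Tuple size_s)) //= eqxx mul1r.
rewrite !big1 ?addr0 // => [n nn|e0 ne|c nc].
- rewrite big1 // => e0 _; rewrite big1 // => c _.
  case: eqP => [[_ Ec]|_]; last by rewrite mul0r.
  by case/eqP: nn; apply: val_inj; rewrite /= -Ec size_tuple.
- rewrite big1 // => c _.
  case: eqP => [[Ee _]|_]; last by rewrite mul0r.
  by case/eqP: ne.
- case: eqP => [[Ec]|_]; last by rewrite mul0r.
  by case/eqP: nc; apply: val_inj.
Qed.

(** Being supported on paths of total [fminus] 0 holds for lazy paths and for cycles of weight 0,
    and passes to linear combinations and products since the total is additive. *)
Lemma phantom_fm (b : base_points G) (u : cpa G R) e s :
  phantom_subalgebra w b u -> u (e, s) != 0 -> fm s = 0%N.
Proof.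
move=> phu; elim: {u} phu e s => [x x0||u v _ IHu _ IHv|z u _ IHu|u v _ IHu _ IHv] e s.
- rewrite /QG /cpa_path; case: ((e, s) =P _) => [[_ ->] _|_]; last by rewrite eqxx.
  by rewrite (sum_site_path (base_in b x) (fminus_compatible xi)).
- rewrite /cpa_one /=; case: (s =P _) => [-> _|_]; last by rewrite eqxx.
  by rewrite big_nil.
- have [u0|/IHu //] := eqVneq (u (e, s)) 0.
  by rewrite (_ : (u + v) (e, s) = u (e, s) + v (e, s)) // u0 add0r => /IHv.
- by rewrite mulf_eq0 negb_or => /andP[_ /IHu].
- rewrite /cpa_mul /=; apply: contra_neq_eq => s0.
  rewrite big1 // => k _; apply/eqP; apply: contraNT s0 => /=.
  rewrite mulf_eq0 negb_or => /andP[/IHu tk /IHv dk].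
  by rewrite -(cat_take_drop k s) big_cat tk dk.
Qed.

Lemma xi_w_gt0 : (0 < xi_w w)%N.
Proof.
rewrite /xi_w; elim/big_ind: _ => // [m n|x]; last by rewrite lt0n.
by rewrite lcmn_gt0 => -> ->.
Qed.

Lemma p_wK x : wval w x != 0%N -> (p_w w x * wval w x = xi_w w)%N.
Proof. by move=> x0; rewrite /p_w divnK // (biglcmn_sup x). Qed.

(** The power [p_w w x] runs through each angle around [x] that many times, and its total [fminus]
    is [p_w w x * wval w x = xi_w w]. The leading factor will cancel the coefficient of this power
    in [S_w]. *)
Lemma sum_cpa_exp_QG (b : base_points G) x alpha (i j N : nat) :
  wval w x != 0%N -> (p_w w x * #|angles x| <= N)%N ->
  \sum_(n < N) \sum_(e0 : edge G) \sum_(c : n.+1.-tuple (angle G))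
    cpa_exp (QG R b x) (p_w w x) (e0, val c) *
      ((count_mem alpha c)%:R * (j == i + fm c)%N%:R) =
  (p_w w x)%:R * (alpha \in angles x)%:R * (j == i + xi_w w)%N%:R.
Proof.
move=> x0 leN; have bx := base_in b x.
have := p_wK x0; have := xi_w_gt0; case: (p_w w x) leN => [|p] leN; first by lia.
move=> _ Exi; rewrite cpa_exp_path; last exact: target_site_path.
rewrite -/(site_path x (b x)); set T := flatten _.
have sizeT : size T = (p.+1 * #|angles x|)%N.
  by rewrite size_flatten /shape map_nseq sumn_nseq size_traject mulnC.
rewrite (sum_cpa_path _ (fun c =>
  (count_mem alpha c)%:R * (j == i + fm c)%N%:R)); last first.
  by rewrite sizeT leN muln_gt0 andbT; apply/card_gt0P; exists (b x).
congr (_ * (nat_of_bool (_ == _ + _)%N)%:R).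
  by rewrite count_flatten map_nseq sumn_nseq count_site_path // natrM mulrC.
rewrite -Exi /T; elim: p.+1 => [|q IHq]; first by rewrite big_nil.
by rewrite /= big_cat /= IHq (sum_site_path bx (fminus_compatible xi)) mulSn.
Qed.

End Main.

(** * Cancellation of the vertex and face terms *)

Theorem proposition5p10 (R : realType) (G : planarGraph) (w : weight G)
    (b : base_points G) (S : cpa G R) (hS : admissible w b S)
    (xi : bms_state w) :
  jacobian_rep (bms_rep R xi) S.
Proof.
case: hS => potS [phS pot_phS].
(* The first summand ensures nilpotency; the second makes the truncation long enough for every power
   of a cycle in [S_w]. *)
exists (#|{: edge G}| * (\max_e bdim xi e) +
  \sum_(x : site G) p_w w x * #|angles x|)%N.
set N := (_ + _)%N; split; first by apply: bms_rep_nilpotent; exact: leq_addr.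
have leN x : (p_w w x * #|angles x| <= N)%N.
  by rewrite /N (bigD1 x) //=; lia.
move=> alpha e e'; apply/matrixP => i j; rewrite act_cyc_derivE // mxE.
have [Ee|ne] := eqVneq e (tgt alpha); last first.
  rewrite big1 // => n _; rewrite big1 // => e0 _; rewrite big1 // => c _.
  by rewrite mulr0.
case: (src alpha == e'); last first.
  rewrite big1 // => n _; rewrite big1 // => e0 _; rewrite big1 // => c _.
  by rewrite mulr0.
(* The column index [j] witnesses that the space at [tgt alpha] is nonzero; this excludes closed
   paths through [alpha] with zero [fminus]. *)
have d_gt0 : (0 < bdim xi (tgt alpha))%N.
  by rewrite -Ee; exact: leq_ltn_trans (ltn_ord j).
pose H (c : seq (angle G)) : complex R := (count_mem alpha c)%:R *
  (j + fminus xi alpha == i + \sum_(a <- c) fminus xi a)%N%:R.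
(* A phantom term through [alpha] would be such a closed path, so only [S_w] contributes. *)
have S_phantom e0 c : S (e0, c) * (count_mem alpha c)%:R =
    S_w R w b (e0, c) * (count_mem alpha c)%:R.
  apply/eqP; rewrite -subr_eq0 -mulrBl mulf_eq0.
  have [//|/= S0] := eqVneq (S (e0, c) - S_w R w b (e0, c)) 0.
  rewrite pnatr_eq0 -leqn0 leqNgt -has_count has_pred1.
  apply: contraTN d_gt0 => c_alpha; rewrite -eqn0Ngt.
  have /and3P[_ Pc /eqP Tc] : is_cyclic_path e0 c.
    by apply: contraNT S0 => /pot_phS phS0; apply/eqP; exact: phS0.
  by have [_ ->] := bdim_closed_path Pc Tc (phantom_fm xi phS S0) c_alpha.
(* [F x] is the contribution of the site [x], up to the sign it carries in [S_w]. *)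
pose F x := (p_w w x)%:R^-1 * (\sum_(n < N) \sum_(e0 : edge G)
  \sum_(c : n.+1.-tuple (angle G))
    cpa_exp (QG R b x) (p_w w x) (e0, val c) * H c).
have FE x : wval w x != 0%N -> F x = (alpha \in angles x)%:R *
    (j + fminus xi alpha == i + xi_w w)%N%:R.
  move=> x0; rewrite /F (sum_cpa_exp_QG R xi) // -mulrA mulKf // pnatr_eq0.
  by apply: contraTneq (xi_w_gt0 w) => p0; rewrite -(p_wK x0) p0.
transitivity (\sum_(v : vertex G | wval w (inl v) != 0%N) F (inl v) -
              \sum_(f : face G | wval w (inr f) != 0%N) F (inr f)).
  have FsumE (I : finType) (P : pred I) (site_of : I -> site G) :
      \sum_(k | P k) F (site_of k) = \sum_(n < N) \sum_(e0 : edge G)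
        \sum_(c : n.+1.-tuple (angle G))
        (\sum_(k | P k) (p_w w (site_of k))%:R^-1 *
          cpa_exp (QG R b (site_of k)) (p_w w (site_of k)) (e0, val c)) * H c.
    rewrite /F; under eq_bigr => k _ do rewrite mulr_sumr.
    rewrite exchange_big; apply: eq_bigr => n _.
    under eq_bigr => k _ do rewrite mulr_sumr.
    rewrite exchange_big; apply: eq_bigr => e0 _.
    under eq_bigr => k _ do rewrite mulr_sumr.
    rewrite exchange_big; apply: eq_bigr => c _.
    by rewrite mulr_suml; apply: eq_bigr => k _; rewrite mulrA.
  rewrite !FsumE -sumrB; apply: eq_bigr => n _.
  rewrite -sumrB; apply: eq_bigr => e0 _.
  rewrite -sumrB; apply: eq_bigr => c _.
  by rewrite -mulrBl S_phantom -mulrA.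
rewrite (eq_bigr _ (fun v hv => FE (inl v) hv)).
rewrite (eq_bigr _ (fun f hf => FE (inr f) hf)).
(* Hence the vertex and the face at [alpha] both occur in [S_w], and each sum reduces to the same
   single term. *)
have site_alpha x : alpha \in angles x -> wval w x != 0%N.
  by move=> ax; exact: wval_neq0 ax d_gt0.
pose v0 : vertex G := exist _ (porbit (nxt G) alpha) (imset_f _ isT).
pose f0 : face G := exist _ (porbit (fnxt G) alpha) (imset_f _ isT).
have v0a : alpha \in angles (inl v0) by exact: porbit_id.
have f0a : alpha \in angles (inr f0) by exact: porbit_id.
have v0P : forall v : vertex G, alpha \in angles (inl v) -> v = v0.
  by move=> v /angles_porbit Ev; apply: val_inj.
have f0P : forall f : face G, alpha \in angles (inr f) -> f = f0.
  by move=> f /angles_porbit Ef; apply: val_inj.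
rewrite -!mulr_suml (sum_mem_unique _ v0P v0a (site_alpha _ v0a)).
by rewrite (sum_mem_unique _ f0P f0a (site_alpha _ f0a)) subrr.
Qed.
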